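(* Let $s\in\mathbb{C}$ with $\operatorname{Re}(s)>0$ and let $x\in\mathbb{C}$ be neither zero nor a negative integer. Then $$\sum_{n=0}^{\infty}\frac{1}{2^{n+1}}\sum_{k=0}^{n}\binom{n}{k}\frac{(-1)^k}{(k+x)^s}=\sum_{n=0}^{\infty}\frac{(-1)^n}{(n+x)^s}=\Phi(-1,s,x).$$
   Context: $\Phi(z,s,x)=\sum_{n=0}^{\infty}\frac{z^n}{(n+x)^s}$ is the Hurwitz-Lerch zeta function (at $z=-1$ it is given by this convergent series). Complex powers $(k+x)^s$ are taken with the principal branch of the logarithm. *)

(* Defs.v *)
From Stdlib Require Export Reals.
From Stdlib Require Import Lra.
From Coquelicot Require Export Coquelicot.

Open Scope R_scope.

Definition Cexp (z : C) : C :=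
  (exp (Re z) * cos (Im z), exp (Re z) * sin (Im z)).

(* Principal argument, with values in (-PI, PI] for z <> 0; in particular it is
   PI on the negative real axis.  Its value at 0 is irrelevant. *)
Definition Carg (z : C) : R :=
  if Rle_dec 0 (Im z) then acos (Re z / Cmod z) else - acos (Re z / Cmod z).

Definition Clog (z : C) : C := (ln (Cmod z), Carg z).

(* Only meaningful for z <> 0. *)
Definition Cpower (z s : C) : C := Cexp (s * Clog z)%C.

(* Coquelicot's Series is real-valued.  Like Series, this is a total operator,
   equal to the sum of the series when the series converges. *)
Definition CSeries (a : nat -> C) : C :=
  (Series (fun n => Re (a n)), Series (fun n => Im (a n))).

Definition Lerch_Phi (z s x : C) : C :=
  CSeries (fun n => (z ^ n / Cpower (INR n + x) s)%C).

Lemma Carg_bound (z : C) : z <> 0 -> - PI < Carg z <= PI.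
Proof.
intros Hz; unfold Carg.
assert (Hm : 0 < Cmod z) by now apply Cmod_gt_0.
destruct (acos_bound (Re z / Cmod z)) as [H1 H2].
pose proof PI_RGT_0.
destruct (Rle_dec 0 (Im z)) as [Hi|Hi]; [lra|].
split; [|lra].
apply Ropp_lt_contravar.
destruct (Rle_lt_or_eq_dec _ _ H2) as [H3|H3]; trivial; exfalso.
assert (Hmod : Cmod z * Cmod z = Re z * Re z + Im z * Im z).
{ unfold Cmod, Re, Im; rewrite sqrt_sqrt; [ring|].
  pose proof (pow2_ge_0 (fst z)); pose proof (pow2_ge_0 (snd z)); lra. }
assert (Hc : -1 < Re z / Cmod z < 1).
{ split.
  - apply (Rmult_lt_reg_r (Cmod z)); [lra|]; field_simplify; [nra|lra].
  - apply (Rmult_lt_reg_r (Cmod z)); [lra|]; field_simplify; [nra|lra]. }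
pose proof (acos_bound_lt _ Hc); lra.
Qed.

Lemma Cexp_Clog (z : C) : z <> 0 -> Cexp (Clog z) = z.
Proof.
intros Hz.
assert (Hm : 0 < Cmod z) by now apply Cmod_gt_0.
assert (Hmod : Cmod z * Cmod z = Re z * Re z + Im z * Im z).
{ unfold Cmod, Re, Im; rewrite sqrt_sqrt; [ring|].
  pose proof (pow2_ge_0 (fst z)); pose proof (pow2_ge_0 (snd z)); lra. }
assert (Hc : -1 <= Re z / Cmod z <= 1).
{ split; apply (Rmult_le_reg_r (Cmod z)); try lra; field_simplify; try lra; nra. }
assert (Hs : Cmod z * sin (acos (Re z / Cmod z)) = Rabs (Im z)).
{ rewrite sin_acos by exact Hc.
  rewrite <- (sqrt_Rsqr (Cmod z)) at 1 by lra.
  rewrite <- sqrt_mult_alt by apply Rle_0_sqr.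
  rewrite <- sqrt_Rsqr_abs; f_equal; unfold Rsqr; field_simplify; [nra|lra]. }
unfold Cexp, Clog, Carg; simpl; rewrite (exp_ln _ Hm).
transitivity (Re z, Im z); [|symmetry; apply surjective_pairing].
destruct (Rle_dec 0 (Im z)) as [Hi|Hi].
- rewrite cos_acos by exact Hc; rewrite Hs, Rabs_pos_eq by exact Hi.
  f_equal; field; lra.
- rewrite cos_neg, sin_neg, cos_acos by exact Hc.
  rewrite <- Ropp_mult_distr_r, Hs, Rabs_left by lra.
  f_equal; [field; lra|ring].
Qed.

Lemma CSeries_unique (a : nat -> C) (l : C) : is_series a l -> CSeries a = l.
Proof.
intros H; unfold CSeries.
assert (Hs : forall n, sum_n a n =
  (sum_n (fun k => Re (a k)) n, sum_n (fun k => Im (a k)) n)).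
{ intros n; induction n as [|n IH].
  - rewrite !sum_O; apply surjective_pairing.
  - rewrite !sum_Sn, IH; reflexivity. }
rewrite (surjective_pairing l); f_equal; apply is_series_unique;
  intros P [eps HP].
- destruct (H (fun z => P (fst z))) as [N HN].
  + exists eps; intros y [Hy _]; apply HP, Hy.
  + exists N; intros n Hn; specialize (HN n Hn); rewrite Hs in HN; exact HN.
- destruct (H (fun z => P (snd z))) as [N HN].
  + exists eps; intros y [_ Hy]; apply HP, Hy.
  + exists N; intros n Hn; specialize (HN n Hn); rewrite Hs in HN; exact HN.
Qed.

(* Main.v *)
From Stdlib Require Import Lra Lia FunctionalExtensionality.
Require Import Defs.

(** The left-hand side is the Euler transform of the alternating series
    [b k = (-1)^k / (k+x)^s] on the right, so two facts suffice.

    Euler's transform preserves the sum of every convergent complex series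
    ([euler_transform]).  Let [S k = b 0 + ... + b (k-1)].  By Pascal's rule
    the partial sums of the transformed series are the binomial means
    [2^-n * sum_k C(n,k) S k], that is, the value at [0] of the [n]-th iterate
    of the operator averaging a sequence with its shift.  These means are
    regular: if [S] tends to [l] then [|S k - l| <= eps + B 2^-k] for a
    suitable [B], and one averaging step turns [B] into [3B/4], so that the
    mean is within [eps + B (3/4)^n] of [l] ([binomial_mean_regular]).

    The alternating series converges ([ex_series_alternating_Cpower]).  On the
    half-plane of positive real part the principal argument is an arctangent,
    so the real and imaginary parts of [(t + x)^(-s)] are smooth real functions
    of the shape [exp A * cos B].  Put [sigma = Re s].  Up to constants, such a
    function [h] has [|h' t| <= t^(-sigma-1)], which is minus the derivative of
    a multiple [g] of [t^(-sigma)].  Hence [g + h] and [g - h] both decrease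
    to [0], and Leibniz' criterion applied to each gives the convergence for
    [h], half their difference. *)

(** * Binomial means and Euler's transform *)

(** The mean [2^-n * sum_k C(n,k) c k], as an iterated average: this form makes
    linearity and norm estimates immediate inductions.  The closed form is
    [binomial_mean_sum]. *)
Fixpoint binomial_mean (n : nat) (c : nat -> C) : C :=
  match n with
  | O => c O
  | S n => ((binomial_mean n c + binomial_mean n (fun k => c (S k))) / 2)%C
  end.

(** Pascal's rule in summed form.  The two end terms are split off because
    [Binomial.C n (S n)], a quotient of factorials of truncated differences,
    is not [0]. *)
Lemma binomial_sum_succ (n : nat) (c : nat -> C) :
  sum_n (fun k => RtoC (Binomial.C (S n) k) * c k)%C (S n) =
  (sum_n (fun k => RtoC (Binomial.C n k) * c k) n +
   sum_n (fun k => RtoC (Binomial.C n k) * c (S k)) n)%C.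
Proof.
assert (split_first : forall (a : nat -> C) m,
          sum_n a (S m) = (a O + sum_n (fun k => a (S k)) m)%C).
{ intros a m; unfold sum_n; rewrite sum_Sn_m by lia.
  rewrite sum_n_m_S; reflexivity. }
destruct n as [|n].
{ rewrite sum_Sn, !sum_O; rewrite !C_n_0, !C_n_n.
  unfold plus; simpl; ring. }
rewrite sum_Sn, split_first, (split_first _ n).
rewrite (sum_Sn (fun k => RtoC (Binomial.C (S n) k) * c (S k))%C).
rewrite !C_n_0, !C_n_n.
rewrite (sum_n_ext_loc
  (fun k => RtoC (Binomial.C (S (S n)) (S k)) * c (S k))%C
  (fun k => plus (RtoC (Binomial.C (S n) (S k)) * c (S k))%C
                 (RtoC (Binomial.C (S n) k) * c (S k))%C)).
- rewrite sum_n_plus; unfold plus; simpl; ring.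
- intros k Hk; rewrite <- pascal by lia; rewrite RtoC_plus.
  unfold plus; simpl; ring.
Qed.

Lemma two_neq_0 : RtoC 2 <> 0%C.
Proof. intros H; apply RtoC_inj in H; lra. Qed.

Lemma binomial_mean_sum (n : nat) (c : nat -> C) :
  binomial_mean n c =
  (/ 2 ^ n * sum_n (fun k => RtoC (Binomial.C n k) * c k) n)%C.
Proof.
revert c; induction n as [|n IH]; intros c.
- rewrite sum_O, C_n_0; simpl; change (c O = / 1 * (1 * c O))%C; field.
- rewrite binomial_sum_succ; simpl binomial_mean; rewrite !IH, Cpow_S.
  field; repeat split; try apply Cpow_nz; exact two_neq_0.
Qed.

Lemma binomial_mean_minus (n : nat) (c d : nat -> C) :
  binomial_mean n (fun k => c k - d k)%C =
  (binomial_mean n c - binomial_mean n d)%C.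
Proof.
revert c d; induction n as [|n IH]; intros c d; simpl; [reflexivity|].
rewrite IH, (IH (fun k => c (S k)) (fun k => d (S k))).
field; exact two_neq_0.
Qed.

Lemma binomial_mean_const (n : nat) (l : C) :
  binomial_mean n (fun _ => l) = l.
Proof.
induction n as [|n IH]; simpl; [reflexivity|].
rewrite IH; field; exact two_neq_0.
Qed.

(** Shifting the sequence halves [B], so averaging with the shift replaces [B]
    by [(B + B/2) / 2], whence the factor [3/4]. *)
Lemma binomial_mean_bound (n : nat) (c : nat -> C) (eps B : R) :
  (forall k, Cmod (c k) <= eps + B * (/ 2) ^ k) ->
  Cmod (binomial_mean n c) <= eps + B * (3 / 4) ^ n.
Proof.
revert c B; induction n as [|n IH]; intros c B Hc; simpl binomial_mean.
- exact (Hc O).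
- pose proof (IH c B Hc) as H0.
  assert (H1 : Cmod (binomial_mean n (fun k => c (S k)))
                 <= eps + B / 2 * (3 / 4) ^ n).
  { apply IH; intros k; eapply Rle_trans; [apply Hc|].
    simpl; apply Req_le; field. }
  rewrite Cmod_div by exact two_neq_0.
  rewrite Cmod_R, (Rabs_pos_eq 2) by lra.
  pose proof (Cmod_triangle (binomial_mean n c)
                (binomial_mean n (fun k => c (S k)))) as H2.
  simpl; lra.
Qed.

(** A convergent sequence is close to its limit except at finitely many
    indices, and a bounded error there is dominated by a multiple of [2^-k];
    [binomial_mean_bound] then makes the contribution of these indices decay
    geometrically. *)
Lemma binomial_mean_regular (c : nat -> C) (l : C) :
  filterlim c eventually (locally l) ->
  filterlim (fun n => binomial_mean n c) eventually (locally l).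
Proof.
intros Hc.
pose proof (fun f => @filterlim_locally_ball_norm
  C_AbsRing nat C_NormedModule eventually _ f l) as Hnorm.
apply Hnorm; intros eps.
destruct (proj1 (Hnorm c) Hc (pos_div_2 eps)) as [K HK]; clear Hnorm.
change (forall k, (K <= k)%nat -> Cmod (c k - l) < eps / 2) in HK.
assert (Hbd : exists M, 0 <= M /\ forall k, (k < K)%nat -> Cmod (c k - l) <= M).
{ clear HK; induction K as [|K [M [HM IH]]].
  - exists 0; split; [lra|intros k Hk; lia].
  - exists (Rmax M (Cmod (c K - l))); split.
    + eapply Rle_trans; [exact HM|apply Rmax_l].
    + intros k Hk; destruct (Nat.eq_dec k K) as [->|Hne]; [apply Rmax_r|].
      eapply Rle_trans; [apply IH; lia|apply Rmax_l]. }
destruct Hbd as [M [HM HMk]].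
(* The factor [2 ^ K] makes the geometric term at least [M] for all [k < K]. *)
assert (Hmaj : forall k, Cmod (c k - l) <= eps / 2 + M * 2 ^ K * (/ 2) ^ k).
{ intros k; pose proof (cond_pos eps) as He.
  assert (H2k : 0 < (/ 2) ^ k) by (apply pow_lt; lra).
  assert (H2K : 0 < 2 ^ K) by (apply pow_lt; lra).
  destruct (Compare_dec.le_lt_dec K k) as [Hk|Hk].
  - pose proof (HK k Hk).
    assert (0 <= M * 2 ^ K * (/ 2) ^ k) by
      (apply Rmult_le_pos; [apply Rmult_le_pos|]; lra).
    lra.
  - pose proof (HMk k Hk) as H.
    assert (H1 : 1 <= 2 ^ K * (/ 2) ^ k).
    { rewrite pow_inv; apply (Rmult_le_reg_r (2 ^ k)); [apply pow_lt; lra|].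
      rewrite Rmult_assoc, Rinv_l, Rmult_1_l, Rmult_1_r by (apply pow_nonzero; lra).
      apply Rle_pow; [lra|lia]. }
    rewrite Rmult_assoc; nra. }
assert (Hgeom : is_lim_seq (fun n => M * 2 ^ K * (3 / 4) ^ n) 0).
{ replace (Finite 0) with (Rbar_mult (M * 2 ^ K) 0)
    by (simpl; f_equal; ring).
  apply is_lim_seq_scal_l, is_lim_seq_geom; rewrite Rabs_pos_eq; lra. }
apply is_lim_seq_spec in Hgeom.
destruct (Hgeom (pos_div_2 eps)) as [N HN]; exists N; intros n Hn.
change (Cmod (binomial_mean n c - l) < eps).
rewrite <- (binomial_mean_const n l) , <- binomial_mean_minus.
pose proof (binomial_mean_bound n _ _ _ Hmaj) as Hb.
specialize (HN n Hn); rewrite Rminus_0_r in HN.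
apply Rabs_def2 in HN; simpl in HN; lra.
Qed.

(** Since [b] is the difference sequence of its partial sums, [b k = S (k+1) -
    S k], the averaging step gives [mean (n+1) S - mean n S = mean n b / 2],
    which is the [n]-th transformed term: the transformed series telescopes to
    binomial means of [S]. *)
Lemma euler_transform (b : nat -> C) (l : C) :
  is_series b l ->
  is_series (fun n => / 2 ^ (n + 1) *
     sum_n (fun k => RtoC (Binomial.C n k) * b k) n)%C l.
Proof.
intros Hb.
(* The empty sum is included as [S' 0 = 0], which makes the telescoping exact. *)
set (S' := fun k => match k with O => RtoC 0 | S j => sum_n b j end).
assert (Hpart : forall n,
  sum_n (fun n => / 2 ^ (n + 1) *
     sum_n (fun k => RtoC (Binomial.C n k) * b k) n)%C n
  = binomial_mean (S n) S').
{ assert (Hstep : forall n, binomial_mean (S n) S' =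
     (binomial_mean n S' + / 2 ^ (n + 1) *
        sum_n (fun k => RtoC (Binomial.C n k) * b k) n)%C).
  { intros n; rewrite Nat.add_1_r, Cpow_S.
    replace (sum_n (fun k => RtoC (Binomial.C n k) * b k)%C n)
      with (2 ^ n * binomial_mean n b)%C
      by (rewrite binomial_mean_sum; field; apply Cpow_nz, two_neq_0).
    replace b with (fun k => S' (S k) - S' k)%C at 1.
    - rewrite binomial_mean_minus; simpl; field.
      repeat split; try apply Cpow_nz; exact two_neq_0.
    - apply functional_extensionality; intros [|k]; unfold S'.
      + rewrite sum_O; ring.
      + rewrite sum_Sn; unfold plus; simpl; ring. }
  induction n as [|n IH].
  - rewrite sum_O, Hstep; simpl binomial_mean; symmetry; apply Cplus_0_l.
  - rewrite sum_Sn, IH, (Hstep (S n)); reflexivity. }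
unfold is_series.
eapply filterlim_ext; [intros n; symmetry; apply Hpart|].
assert (HS : filterlim S' eventually (locally l)).
{ intros P HP; destruct (Hb P HP) as [N HN]; exists (S N).
  intros [|n] Hn; [lia|apply HN; lia]. }
intros P HP; destruct (binomial_mean_regular S' l HS P HP) as [N HN].
exists N; intros n Hn; apply HN; lia.
Qed.

(** * Alternating series of functions of dominated variation *)

Lemma ex_series_alternating (u : nat -> R) :
  (forall k, u (S k) <= u k) -> is_lim_seq u 0 ->
  ex_series (fun k => (-1) ^ k * u k).
Proof.
intros Hdec Hlim; apply is_lim_seq_Reals in Hlim.
destruct (alternated_series u Hdec Hlim) as [l Hl]; exists l.
apply is_series_Reals; exact Hl.
Qed.

Lemma decreasing_of_derive (f df : R -> R) (a b : R) :
  a < b -> (forall t, a <= t <= b -> is_derive f t (df t)) ->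
  (forall t, a <= t <= b -> df t <= 0) -> f b <= f a.
Proof.
intros Hab Hd Hneg.
destruct (MVT_cor2 f df a b Hab) as [t [Ht Hin]].
{ intros t Ht; apply is_derive_Reals, Hd, Ht. }
pose proof (Hneg t ltac:(lra)); nra.
Qed.

(** The domination [|h'| <= - g'] makes both [g + h] and [g - h] decreasing;
    [h] itself need not be monotone. *)
Lemma ex_series_alternating_dominated (h dh g dg : R -> R) (p : R) :
  (forall t, p <= t -> is_derive h t (dh t)) ->
  (forall t, p <= t -> is_derive g t (dg t)) ->
  (forall t, p <= t -> Rabs (dh t) <= - dg t) ->
  is_lim_seq (fun k => h (p + INR k)) 0 ->
  is_lim_seq (fun k => g (p + INR k)) 0 ->
  ex_series (fun k => (-1) ^ k * h (p + INR k)).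
Proof.
intros Hh Hg Hdom Lh Lg.
assert (Hk : forall k, p <= p + INR k) by (intros k; pose proof (pos_INR k); lra).
assert (H1 : ex_series (fun k => (-1) ^ k * (g (p + INR k) + h (p + INR k)))).
{ apply ex_series_alternating.
  - intros k; rewrite S_INR; pose proof (Hk k).
    apply (decreasing_of_derive (fun t => g t + h t) (fun t => dg t + dh t)); [lra| |].
    + intros t Ht; apply (is_derive_plus (V := R_NormedModule)); [apply Hg|apply Hh]; lra.
    + intros t Ht; pose proof (Hdom t ltac:(lra)) as Hb; apply Rabs_le_between in Hb; lra.
  - replace 0 with (0 + 0) by ring; apply is_lim_seq_plus'; assumption. }
assert (H2 : ex_series (fun k => (-1) ^ k * (g (p + INR k) - h (p + INR k)))).
{ apply ex_series_alternating.
  - intros k; rewrite S_INR; pose proof (Hk k).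
    apply (decreasing_of_derive (fun t => g t - h t) (fun t => dg t - dh t)); [lra| |].
    + intros t Ht; apply (is_derive_minus (V := R_NormedModule)); [apply Hg|apply Hh]; lra.
    + intros t Ht; pose proof (Hdom t ltac:(lra)) as Hb; apply Rabs_le_between in Hb; lra.
  - replace 0 with (0 - 0) by ring; apply is_lim_seq_minus'; assumption. }
pose proof (ex_series_scal (/ 2) _ (ex_series_minus _ _ H1 H2)) as H3.
eapply ex_series_ext; [|exact H3].
intros k; unfold scal, minus, plus, opp; simpl; unfold mult; simpl; field.
Qed.

(** * Convergence of the alternating power series *)

Lemma is_lim_seq_exp_neg_ln (sigma p : R) :
  0 < sigma -> 0 < p ->
  is_lim_seq (fun k => exp (- sigma * ln (p + INR k))) 0.
Proof.
intros Hs Hp.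
apply (is_lim_comp_seq exp _ m_infty 0); [exact is_lim_exp_m| |].
{ exists O; intros n _; discriminate. }
replace m_infty with (Rbar_mult (- sigma) p_infty).
2:{ simpl; destruct (Rle_dec 0 (- sigma)) as [Hle|]; [exfalso; lra|reflexivity]. }
apply is_lim_seq_scal_l.
apply (is_lim_comp_seq ln _ p_infty p_infty); [exact is_lim_ln_p| |].
{ exists O; intros n _; discriminate. }
eapply is_lim_seq_plus; [apply is_lim_seq_const|apply is_lim_seq_INR|reflexivity].
Qed.

(** The dominating function is a multiple of [t^(-sigma)]: the derivative of
    [exp A * cos B] is [exp A] times a quantity of order [1/t], and [exp A] is
    of order [t^(-sigma)]. *)
Lemma ex_series_alternating_oscillating (A dA B dB : R -> R) (sigma c D p : R) :
  0 < sigma -> 0 < p ->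
  (forall t, p <= t -> is_derive A t (dA t)) ->
  (forall t, p <= t -> is_derive B t (dB t)) ->
  (forall t, p <= t -> Rabs (dA t) <= c / t) ->
  (forall t, p <= t -> Rabs (dB t) <= c / t) ->
  (forall t, p <= t -> A t <= D - sigma * ln t) ->
  ex_series (fun k => (-1) ^ k * (exp (A (p + INR k)) * cos (B (p + INR k)))).
Proof.
intros Hs Hp HA HB HdA HdB Hbd.
assert (Hexp : forall t, p <= t -> exp (A t) <= exp D * exp (- sigma * ln t)).
{ intros t Ht; rewrite <- exp_plus.
  destruct (Rle_lt_or_eq_dec _ _ (Hbd t Ht)) as [H|H].
  - left; apply exp_increasing; lra.
  - right; f_equal; lra. }
(* [M] is chosen so that [M * sigma / t] is [exp D] times the bound [2 * c / t]
   of [dA * cos B - dB * sin B]. *)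
set (M := 2 * c * exp D / sigma).
assert (Lg : forall M', is_lim_seq (fun k => M' * exp (- sigma * ln (p + INR k))) 0).
{ intros M'; replace (Finite 0) with (Rbar_mult M' 0) by (simpl; f_equal; ring).
  apply is_lim_seq_scal_l, is_lim_seq_exp_neg_ln; assumption. }
apply (ex_series_alternating_dominated
  (fun t => exp (A t) * cos (B t))
  (fun t => exp (A t) * (dA t * cos (B t) - dB t * sin (B t)))
  (fun t => M * exp (- sigma * ln t))
  (fun t => M * (- sigma / t * exp (- sigma * ln t)))).
- intros t Ht; pose proof (HA t Ht) as H1; pose proof (HB t Ht) as H2.
  auto_derive.
  + split; [exists (dA t); exact H1|]; split; [exists (dB t); exact H2|exact I].
  + change (fun x => A x) with A; change (fun x => B x) with B.
    rewrite (is_derive_unique _ _ _ H1), (is_derive_unique _ _ _ H2); ring.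
- intros t Ht; auto_derive; [lra|field; lra].
- intros t Ht.
  pose proof (HdA t Ht) as H1; pose proof (HdB t Ht) as H2.
  pose proof (Hexp t Ht) as H3; pose proof (exp_pos (A t)) as H4.
  rewrite Rabs_mult, (Rabs_pos_eq (exp (A t))) by lra.
  assert (H5 : Rabs (dA t * cos (B t) - dB t * sin (B t)) <= 2 * (c / t)).
  { eapply Rle_trans; [apply Rabs_triang|].
    rewrite Rabs_Ropp, !Rabs_mult.
    assert (Rabs (cos (B t)) <= 1) by (apply Rabs_le, COS_bound).
    assert (Rabs (sin (B t)) <= 1) by (apply Rabs_le, SIN_bound).
    pose proof (Rabs_pos (dA t)); pose proof (Rabs_pos (dB t)).
    pose proof (Rabs_pos (cos (B t))); pose proof (Rabs_pos (sin (B t))).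
    nra. }
  apply Rle_trans with (exp D * exp (- sigma * ln t) * (2 * (c / t))).
  + apply Rmult_le_compat; try apply Rabs_pos; lra.
  + right; unfold M; field; lra.
- apply is_lim_seq_abs_0.
  apply (is_lim_seq_le_le (fun _ => 0) _ (fun k => exp D * exp (- sigma * ln (p + INR k)))).
  + intros k; split; [apply Rabs_pos|].
    rewrite Rabs_mult, (Rabs_pos_eq (exp _)) by (left; apply exp_pos).
    assert (Rabs (cos (B (p + INR k))) <= 1) by (apply Rabs_le, COS_bound).
    pose proof (exp_pos (A (p + INR k))).
    pose proof (Hexp (p + INR k) ltac:(pose proof (pos_INR k); lra)); nra.
  + apply is_lim_seq_const.
  + apply Lg.
- apply Lg.
Qed.

(** Turns the argument into a function that can be differentiated along
    horizontal lines. *)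
Lemma Carg_atan (z : C) : 0 < Re z -> Carg z = atan (Im z / Re z).
Proof.
intros Hz.
assert (Hm : 0 < Cmod z).
{ apply Cmod_gt_0; intros ->; simpl in Hz; lra. }
assert (Hmod : Cmod z * Cmod z = Re z * Re z + Im z * Im z).
{ unfold Cmod, Re, Im; rewrite sqrt_sqrt; [ring|].
  pose proof (pow2_ge_0 (fst z)); pose proof (pow2_ge_0 (snd z)); lra. }
assert (Hac : acos (Re z / Cmod z) = atan (Rabs (Im z) / Re z)).
{ rewrite acos_atan by (apply Rdiv_lt_0_compat; assumption).
  replace (1 - (Re z / Cmod z)²) with ((Im z / Cmod z)²).
  2:{ unfold Rsqr; field_simplify; [|lra|lra].
      replace (Cmod z ^ 2) with (Cmod z * Cmod z) by ring.
      rewrite Hmod; field; nra. }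
  rewrite sqrt_Rsqr_abs, Rabs_div, (Rabs_pos_eq (Cmod z)) by lra.
  f_equal; field; lra. }
unfold Carg; rewrite Hac.
destruct (Rle_dec 0 (Im z)) as [Hi|Hi].
- rewrite Rabs_pos_eq by lra; reflexivity.
- rewrite Rabs_left, <- atan_opp by lra; f_equal; field; lra.
Qed.

Lemma ln_Cmod (z : C) : 0 < Re z -> ln (Cmod z) = / 2 * ln (Re z ^ 2 + Im z ^ 2).
Proof.
intros Hz; unfold Cmod.
change (fst z) with (Re z); change (snd z) with (Im z).
assert (Hp : 0 < Re z ^ 2 + Im z ^ 2) by nra.
rewrite <- (sqrt_sqrt (Re z ^ 2 + Im z ^ 2)) at 2 by lra.
rewrite ln_mult by (apply sqrt_lt_R0; exact Hp); field.
Qed.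

(** For [z = t + i v] with [t > 0], [A] and [B - c0] are the real and imaginary
    parts of [- s * log z], so [exp A * cos B] is the real part
    of [exp (i c0) * z^(-s)].  The phase [c0] serves to treat real parts ([c0 = 0])
    and imaginary parts ([c0 = - PI / 2]) at once. *)
Lemma ex_series_alternating_power (s : C) (v c0 p : R) :
  0 < Re s -> 0 < p ->
  let A t := - (Re s * (/ 2 * ln (t ^ 2 + v ^ 2)) - Im s * atan (v / t)) in
  let B t := - (Re s * atan (v / t) + Im s * (/ 2 * ln (t ^ 2 + v ^ 2))) + c0 in
  ex_series (fun k => (-1) ^ k * (exp (A (p + INR k)) * cos (B (p + INR k)))).
Proof.
intros Hs Hp A B.
set (a := Re s) in *; set (b := Im s) in *.
set (q := 1 + Rabs v / p).
(* [dl] and [dth] are the derivatives of the modulus and argument parts of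
   [log (t + i v)]; both are bounded by [q / t] for [t >= p]. *)
set (dl := fun t => t / (t ^ 2 + v ^ 2)).
set (dth := fun t => - v / (t ^ 2 + v ^ 2)).
assert (Hq : forall t, p <= t -> Rabs (dl t) <= q / t /\ Rabs (dth t) <= q / t).
{ intros t Ht; unfold dl, dth, q.
  assert (Hpos : 0 < t ^ 2 + v ^ 2) by nra.
  pose proof (Rabs_pos v) as Hv.
  assert (Hvp : 0 <= Rabs v / p) by (apply Rdiv_le_0_compat; lra).
  assert (Hvt : Rabs v <= (1 + Rabs v / p) * t).
  { apply Rle_trans with (Rabs v / p * p); [right; field; lra|nra]. }
  rewrite !Rabs_div, Rabs_Ropp, (Rabs_pos_eq (t ^ 2 + v ^ 2)), (Rabs_pos_eq t) by lra.
  split.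
  - apply (Rmult_le_reg_r (t * (t ^ 2 + v ^ 2))); [nra|].
    replace (t / (t ^ 2 + v ^ 2) * (t * (t ^ 2 + v ^ 2))) with (t ^ 2) by (field; lra).
    replace ((1 + Rabs v / p) / t * (t * (t ^ 2 + v ^ 2)))
      with ((1 + Rabs v / p) * (t ^ 2 + v ^ 2)) by (field; lra).
    nra.
  - apply (Rmult_le_reg_r (t * (t ^ 2 + v ^ 2))); [nra|].
    replace (Rabs v / (t ^ 2 + v ^ 2) * (t * (t ^ 2 + v ^ 2))) with (Rabs v * t) by (field; lra).
    replace ((1 + Rabs v / p) / t * (t * (t ^ 2 + v ^ 2)))
      with ((1 + Rabs v / p) * (t ^ 2 + v ^ 2)) by (field; lra).
    nra. }
assert (Hcomb : forall e1 e2 t, p <= t -> Rabs e1 <= Rabs a + Rabs b ->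
   Rabs e2 <= Rabs a + Rabs b ->
   Rabs (e1 * dl t + e2 * dth t) <= 2 * (Rabs a + Rabs b) * q / t).
{ intros e1 e2 t Ht He1 He2; destruct (Hq t Ht) as [H1 H2].
  eapply Rle_trans; [apply Rabs_triang|]; rewrite !Rabs_mult.
  replace (2 * (Rabs a + Rabs b) * q / t) with
    ((Rabs a + Rabs b) * (q / t) + (Rabs a + Rabs b) * (q / t)) by (field; lra).
  apply Rplus_le_compat; apply Rmult_le_compat; try apply Rabs_pos; assumption. }
pose proof (Rabs_pos a) as Ha0; pose proof (Rabs_pos b) as Hb0.
apply (ex_series_alternating_oscillating
  A (fun t => - a * dl t + b * dth t) B (fun t => - b * dl t + - a * dth t)
  a (2 * (Rabs a + Rabs b) * q) (Rabs b * (PI / 2)) p); try assumption.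
- intros t Ht; unfold A, dl, dth; assert (0 < t ^ 2 + v ^ 2) by nra.
  auto_derive; [repeat split; simpl in *; lra|].
  unfold Rsqr in *. simpl in *. field; repeat split; try nra.
- intros t Ht; unfold B, dl, dth; assert (0 < t ^ 2 + v ^ 2) by nra.
  auto_derive; [repeat split; simpl in *; lra|].
  unfold Rsqr in *. simpl in *. field; repeat split; try nra.
- intros t Ht; apply Hcomb; rewrite ?Rabs_Ropp; lra.
- intros t Ht; apply Hcomb; rewrite ?Rabs_Ropp; lra.
- intros t Ht; unfold A.
  assert (H1 : b * atan (v / t) <= Rabs b * (PI / 2)).
  { eapply Rle_trans; [apply Rle_abs|]; rewrite Rabs_mult.
    apply Rmult_le_compat_l; [assumption|].
    pose proof (atan_bound (v / t)); apply Rabs_le; lra. }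
  assert (H2 : ln t <= / 2 * ln (t ^ 2 + v ^ 2)).
  { replace (ln t) with (/ 2 * ln (t ^ 2)).
    - apply Rmult_le_compat_l; [lra|]; apply ln_le; nra.
    - simpl; rewrite Rmult_1_r, ln_mult by lra; field. }
  nra.
Qed.

Lemma ex_series_C (a : nat -> C) :
  ex_series (fun n => Re (a n)) -> ex_series (fun n => Im (a n)) -> ex_series a.
Proof.
intros [l1 H1] [l2 H2]; exists (l1, l2).
assert (Hs : forall n, (sum_n (fun k => Re (a k)) n, sum_n (fun k => Im (a k)) n)
                       = sum_n a n).
{ intros n; induction n as [|n IH].
  - rewrite !sum_O; symmetry; apply surjective_pairing.
  - rewrite !sum_Sn, <- IH; reflexivity. }
unfold is_series; apply (filterlim_ext _ _ Hs).
intros P [eps HP].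
destruct (H1 (ball l1 eps) (locally_ball l1 eps)) as [N1 HN1].
destruct (H2 (ball l2 eps) (locally_ball l2 eps)) as [N2 HN2].
exists (N1 + N2)%nat; intros n Hn; apply HP; split; [apply HN1|apply HN2]; lia.
Qed.

(** The form of the terms to which [ex_series_alternating_power] applies. *)
Lemma alternating_power_term (s z : C) (k : nat) :
  ((-1) ^ k / Cpower z s)%C =
  ((-1) ^ k * (exp (- Re (s * Clog z)%C) * cos (- Im (s * Clog z)%C)),
   (-1) ^ k * (exp (- Re (s * Clog z)%C) * sin (- Im (s * Clog z)%C))).
Proof.
assert (Hinv : (/ Cpower z s)%C = Cexp (- (s * Clog z))).
{ unfold Cpower; generalize (s * Clog z)%C; intros w.
  assert (Hmul : (Cexp w * Cexp (- w) = 1)%C).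
  { unfold Cexp; simpl; rewrite exp_Ropp, cos_neg, sin_neg.
    pose proof (exp_pos (Re w)) as He; pose proof (sin2_cos2 (Im w)) as Hsc.
    unfold Rsqr, Cmult, Re, Im in *; simpl; unfold RtoC. f_equal; field_simplify; try lra. }
  assert (Hnz : Cexp w <> 0%C).
  { intros H; rewrite H, Cmult_0_l in Hmul; apply RtoC_inj in Hmul; lra. }
  rewrite <- (Cmult_1_r (/ _)), <- Hmul, Cmult_assoc, Cinv_l by exact Hnz; ring. }
unfold Cdiv; rewrite Hinv.
replace ((-1) ^ k)%C with (RtoC ((-1) ^ k)).
2:{ rewrite RtoC_pow. reflexivity. }
unfold Cexp, Cmult, RtoC; simpl; f_equal; ring.
Qed.

(** Finitely many terms may lie outside the half-plane where the argument is an
    arctangent; they are dropped. *)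
Lemma ex_series_alternating_Cpower (s x : C) :
  0 < Re s -> ex_series (fun n => (-1) ^ n / Cpower (INR n + x) s)%C.
Proof.
intros Hs.
destruct (INR_archimed 1 (1 + Rabs (Re x)) Rlt_0_1) as [N HN].
pose proof (Rle_abs (- Re x)) as Habs; rewrite Rabs_Ropp in Habs.
set (p := INR N + Re x).
assert (Hp : 0 < p) by (unfold p; lra).
apply (ex_series_incr_n _ N).
assert (Hlog : forall k, Clog (INR (N + k) + x)%C =
  (/ 2 * ln ((p + INR k) ^ 2 + Im x ^ 2), atan (Im x / (p + INR k)))).
{ intros k; unfold Clog.
  assert (HRe : Re (INR (N + k) + x)%C = p + INR k).
  { unfold p; rewrite plus_INR; simpl; unfold Re; ring. }
  assert (HIm : Im (INR (N + k) + x)%C = Im x) by (simpl; unfold Im; ring).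
  pose proof (pos_INR k).
  rewrite ln_Cmod, Carg_atan by (rewrite HRe; lra).
  rewrite HRe, HIm; reflexivity. }
apply ex_series_C.
- pose proof (ex_series_scal ((-1) ^ N) _
    (ex_series_alternating_power s (Im x) 0 p Hs Hp)) as H.
  eapply ex_series_ext; [|exact H]; intros k; cbv beta zeta.
  rewrite alternating_power_term, Hlog, pow_add.
  unfold scal; simpl; unfold mult; simpl; rewrite Rplus_0_r; unfold Re, Im; ring.
- pose proof (ex_series_scal ((-1) ^ N) _
    (ex_series_alternating_power s (Im x) (- (PI / 2)) p Hs Hp)) as H.
  eapply ex_series_ext; [|exact H]; intros k; cbv beta zeta.
  rewrite alternating_power_term, Hlog, pow_add.
  rewrite <- cos_shift.
  unfold scal; simpl; unfold mult; simpl.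
  rewrite <- (cos_neg (PI / 2 - _)), Rmult_assoc.
  do 3 f_equal. unfold Re, Im; f_equal; ring.
Qed.

(** * The Euler-transformed series for the Lerch function *)

Theorem theorem4p5 (s x : C) (hs : 0 < Re s)
    (hx : forall m : nat, x <> RtoC (- INR m)) :
  let euler_term : nat -> C := fun n =>
    (/ 2 ^ (n + 1) *
     sum_n (fun k => RtoC (Binomial.C n k) * ((-1) ^ k / Cpower (INR k + x) s)) n)%C in
  let alt_term : nat -> C := fun n => ((-1) ^ n / Cpower (INR n + x) s)%C in
  ex_series euler_term /\ ex_series alt_term /\
  CSeries euler_term = CSeries alt_term /\
  CSeries alt_term = Lerch_Phi (-1) s x.
Proof.
intros euler_term alt_term.
destruct (ex_series_alternating_Cpower s x hs) as [l Hl].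
pose proof (euler_transform _ l Hl) as He.
repeat split.
- exists l; exact He.
- exists l; exact Hl.
- transitivity l; [|symmetry]; apply CSeries_unique; [exact He|exact Hl].
Qed.
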